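(* Let $X$ be a real Banach space with the separable complementation property which contains an isomorphic copy of $\ell_1$. Then there is an equivalent norm on $X$ such that the bidual $X^{**}$, endowed with the bidual norm of this new norm, is octahedral.
   Context: All Banach spaces are real. A Banach space $X$ has the separable complementation property if for every separable subspace $Y$ of $X$ there is a complemented separable subspace $Z$ of $X$ such that $Y\subset Z$. A Banach space $X$ with unit sphere $S_X$ is called octahedral if for every finite-dimensional subspace $E$ of $X$ and every $\varepsilon>0$ there is $y\in S_X$ such that $\|x+y\|\ge(1-\varepsilon)(\|x\|+\|y\|)$ for all $x\in E$. *)

(* Defs.v *)
From HB Require Import structures.
From mathcomp Require Import all_boot all_order all_algebra.
From mathcomp Require Import all_classical all_reals all_analysis.

Set Implicit Arguments.
Unset Strict Implicit.
Unset Printing Implicit Defensive.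

Import Order.TTheory GRing.Theory Num.Theory.
Import numFieldNormedType.Exports.

Local Open Scope classical_set_scope.
Local Open Scope ring_scope.

Section dual.
Context {R : realType} (X : normedModType R).

Definition is_dual : {pred X -> R^o} :=
  [pred f : X -> R^o | `[< linear f /\ continuous f >]].

Lemma is_dualP (f : X -> R^o) :
  reflect (linear f /\ continuous f) (f \in is_dual).
Proof. exact: asboolP. Qed.

Record dual : Type := Dual {
  dual_fun :> X -> R^o;
  _ : dual_fun \in is_dual }.

HB.instance Definition _ := [isSub for dual_fun].
HB.instance Definition _ := [Choice of dual by <:].

Lemma is_dual_submod_closed : submod_closed is_dual.
Proof.
split=> [|a f g].
  apply/is_dualP; split=> [k x y|]; last exact: cst_continuous.
  by rewrite scaler0 addr0.
move=> /is_dualP[lf cf] /is_dualP[lg cg]; apply/is_dualP; split.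
  move=> k x y; rewrite !fctE lf lg !scalerDr !scalerA (mulrC a k).
  by rewrite addrACA.
by move=> x; apply: cvgD; [apply: cvgZr; exact: cf|exact: cg].
Qed.

HB.instance Definition _ :=
  GRing.isSubmodClosed.Build R (X -> R^o) is_dual is_dual_submod_closed.
HB.instance Definition _ := [SubChoice_isSubLmodule of dual by <:].

Lemma dual_linear (f : dual) : linear f.
Proof. by have /is_dualP[] := valP f. Qed.

Lemma dual_continuous (f : dual) : continuous f.
Proof. by have /is_dualP[] := valP f. Qed.

HB.instance Definition _ (f : dual) :=
  GRing.isLinear.Build R X R^o _ (dual_fun f) (@dual_linear f).

Definition dual_norm (f : dual) : R :=
  sup [set `|f x| | x in [set x | `|x| <= 1]].

Lemma dual_norm_has_sup (f : dual) :
  has_sup [set `|f x| | x in [set x | `|x| <= 1]].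
Proof.
split; first by exists `|f 0|; exists 0 => //=; rewrite normr0.
have /linear_bounded_continuous/linear_boundedP/pinfty_ex_gt0[r r0 fr] :=
  @dual_continuous f.
exists r => _ [x /= x1 <-]; apply: (le_trans (fr x)).
by rewrite -[leRHS]mulr1 ler_wpM2l// ltW.
Qed.

Lemma dual_norm_ub (f : dual) x : `|x| <= 1 -> `|f x| <= dual_norm f.
Proof.
move=> x1; apply: ub_le_sup; last by exists x.
by have [] := dual_norm_has_sup f.
Qed.

Lemma dual_norm_ge0 (f : dual) : 0 <= dual_norm f.
Proof. by apply: le_trans (@dual_norm_ub f 0 _); rewrite ?normr0. Qed.

Lemma dual_norm_le (f : dual) M :
  (forall x, `|x| <= 1 -> `|f x| <= M) -> dual_norm f <= M.
Proof.
move=> fM; apply: ge_sup; first by have [] := dual_norm_has_sup f.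
by move=> _ [x /= x1 <-]; exact: fM.
Qed.

Lemma dual_normD (f g : dual) : dual_norm (f + g) <= dual_norm f + dual_norm g.
Proof.
apply: dual_norm_le => x x1; apply: le_trans (ler_normD _ _) _.
by apply: lerD; exact: dual_norm_ub.
Qed.

Lemma dual_normZ_le (a : R) (f : dual) : dual_norm (a *: f) <= `|a| * dual_norm f.
Proof.
apply: dual_norm_le => x x1.
have -> : (a *: f) x = a * f x by [].
by rewrite normrM ler_wpM2l//; exact: dual_norm_ub.
Qed.

Lemma dual_normZ (a : R) (f : dual) : dual_norm (a *: f) = `|a| * dual_norm f.
Proof.
apply/eqP; rewrite eq_le dual_normZ_le /=.
have [->|a0] := eqVneq a 0; first by rewrite normr0 mul0r dual_norm_ge0.
rewrite -ler_pdivlMl ?normr_gt0// -normfV.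
by rewrite -[X in dual_norm X <= _](scalerK a0) dual_normZ_le.
Qed.

Lemma dual_norm_eq0 (f : dual) : dual_norm f = 0 -> f = 0.
Proof.
move=> f0; apply/val_inj/funext => x /=.
have [->|x0] := eqVneq x 0; first by rewrite linear0.
have : `|f (`|x|^-1 *: x)| <= 0.
  rewrite -f0; apply: dual_norm_ub.
  by rewrite normrZ normfV normr_id mulVf// normr_eq0.
rewrite linearZ normr_le0 scaler_eq0 invr_eq0 normr_eq0 (negPf x0) /=.
by move/eqP.
Qed.

HB.instance Definition _ := Lmodule_isNormed.Build R dual
  dual_normD dual_normZ dual_norm_eq0.

End dual.
Arguments dual {R} X.

Section ell1.
Context (R : realType).

Definition is_ell1 : {pred nat -> R^o} :=
  [pred u : nat -> R^o | `[< cvgn (series (fun n => `|u n| : R)) >]].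

Lemma is_ell1P (u : nat -> R^o) :
  reflect (cvgn (series (fun n => `|u n| : R))) (u \in is_ell1).
Proof. exact: asboolP. Qed.

Record ell1 : Type := Ell1 {
  ell1_seq :> nat -> R^o;
  _ : ell1_seq \in is_ell1 }.

HB.instance Definition _ := [isSub for ell1_seq].
HB.instance Definition _ := [Choice of ell1 by <:].

Lemma is_ell1_submod_closed : submod_closed is_ell1.
Proof.
split=> [|a u v].
  apply/is_ell1P.
  rewrite (_ : series _ = cst 0); first exact: is_cvg_cst.
  by apply/funext => n; rewrite /series/= big1// => i _; rewrite normr0.
move=> /is_ell1P cu /is_ell1P cv; apply/is_ell1P.
have cau : cvgn (series (fun n => `|a| * `|u n| : R)).
  by rewrite (_ : (fun n => _) = `|a| *: (fun n => `|u n| : R))//;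
    exact: is_cvg_seriesZ.
apply: (@series_le_cvg _ _ (fun n => `|a| * `|u n| + `|v n| : R)) => [n|n|n|].
- exact: normr_ge0.
- by rewrite addr_ge0// mulr_ge0.
- by rewrite (le_trans (ler_normD _ _))// lerD2r -normrM.
- exact: (is_cvg_seriesD cau cv).
Qed.

HB.instance Definition _ :=
  GRing.isSubmodClosed.Build R (nat -> R^o) is_ell1 is_ell1_submod_closed.
HB.instance Definition _ := [SubChoice_isSubLmodule of ell1 by <:].

Definition ell1_norm (u : ell1) : R := limn (series (fun n => `|u n| : R)).

Lemma ell1_cvg (u : ell1) : cvgn (series (fun n => `|u n| : R)).
Proof. exact/is_ell1P/(valP u). Qed.

Lemma ell1_normZ (a : R) (u : ell1) : ell1_norm (a *: u) = `|a| * ell1_norm u.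
Proof.
rewrite /ell1_norm (_ : (fun n => _) = `|a| *: (fun n => `|u n| : R)).
  by rewrite lim_seriesZ//; exact: ell1_cvg.
by apply/funext => n; exact: normrM.
Qed.

Lemma ell1_normD (u v : ell1) : ell1_norm (u + v) <= ell1_norm u + ell1_norm v.
Proof.
rewrite /ell1_norm -lim_seriesD; [|exact: ell1_cvg|exact: ell1_cvg].
apply: lim_series_le => [||n]; first exact: ell1_cvg.
- by apply: is_cvg_seriesD; exact: ell1_cvg.
- exact: ler_normD.
Qed.

Lemma ell1_norm_ub (u : ell1) n : `|u n| <= ell1_norm u.
Proof.
have nd : nondecreasing_seq (series (fun n => `|u n| : R)).
  by apply/nondecreasing_seqP => k; rewrite seriesSr lerDl.
have := nondecreasing_cvgn_le nd (@ell1_cvg u) n.+1.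
by apply: le_trans; rewrite seriesSr lerDr sumr_ge0.
Qed.

Lemma ell1_norm_eq0 (u : ell1) : ell1_norm u = 0 -> u = 0.
Proof.
move=> u0; apply/val_inj/funext => n /=; apply/eqP.
by rewrite -normr_le0; have := ell1_norm_ub u n; rewrite u0.
Qed.

HB.instance Definition _ := Lmodule_isNormed.Build R ell1
  ell1_normD ell1_normZ ell1_norm_eq0.

End ell1.

Section renorming.
Context {R : realType}.

Record equivalent_norm (X : normedModType R) := EquivalentNorm {
  eqv_norm :> X -> R;
  eqv_normD : forall x y, eqv_norm (x + y) <= eqv_norm x + eqv_norm y;
  eqv_normZ : forall (a : R) x, eqv_norm (a *: x) = `|a| * eqv_norm x;
  eqv_norm_eq0 : forall x, eqv_norm x = 0 -> x = 0;
  eqv_norm_bounds : exists c C : R, 0 < c /\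
    forall x, c * `|x| <= eqv_norm x <= C * `|x| }.

Definition renormed (X : normedModType R) (N : equivalent_norm X) : Type := X.

HB.instance Definition _ (X : normedModType R) (N : equivalent_norm X) :=
  GRing.Lmodule.copy (renormed N) X.
HB.instance Definition _ (X : normedModType R) (N : equivalent_norm X) :=
  Lmodule_isNormed.Build R (renormed N)
    (eqv_normD N) (eqv_normZ N) (@eqv_norm_eq0 _ N).

End renorming.

Section banach_notions.
Context {R : realType}.
Implicit Type X : normedModType R.

(* In the Banach space setting a subspace is a closed linear subspace. *)
Definition closed_subspace X (A : set X) : Prop :=
  [/\ A 0, forall (a : R) x y, A x -> A y -> A (a *: x + y) & closed A].

Definition separable_set X (A : set X) : Prop :=
  exists D : set X, [/\ countable D, D `<=` A & A `<=` closure D].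

Definition complemented X (Z : set X) : Prop :=
  exists P : {linear X -> X},
    [/\ continuous P, range P = Z & forall z, Z z -> P z = z].

Definition separable_complementation_property X : Prop :=
  forall Y : set X, closed_subspace Y -> separable_set Y ->
  exists Z : set X,
    [/\ closed_subspace Z, separable_set Z, complemented Z & Y `<=` Z].

Definition contains_isomorphic_copy (W X : normedModType R) : Prop :=
  exists (T : {linear W -> X}) (c C : R), 0 < c /\
    forall w, c * `|w| <= `|T w| <= C * `|w|.

Definition finite_dimensional_subspace X (E : set X) : Prop :=
  exists (n : nat) (e : 'I_n -> X),
    E = [set x | exists a : 'I_n -> R, x = \sum_(i < n) a i *: e i].

Definition octahedral X : Prop :=
  forall E : set X, finite_dimensional_subspace E ->
  forall eps : R, 0 < eps ->
  exists y : X, `|y| = 1 /\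
    forall x, E x -> (1 - eps) * (`|x| + `|y|) <= `|x + y|.

End banach_notions.
Arguments separable_complementation_property {R} X.
Arguments contains_isomorphic_copy {R} W X.
Arguments octahedral {R} X.

(* Main.v *)
(* Let [e_k] be the images in X of the unit vectors of ell1. For every sign
   pattern w of length n, Hahn-Banach gives z_w in X* with z_w(e_i) = w_i for
   i < n and norm at most 1/c. For s in {-1,1}^N let a_(n,s) be the average of
   the z_w when the bits of w are independent, w_i agreeing with s_i with
   probability 3/4. Then a_(n,s)(e_i) = s_i/2. If s^k is s with its k-th bit
   set to a given value, the densities of the laws of s^k with respect to the
   law of s have orthogonal increments, so any signed sum of K of the
   a_(n,s^k) - a_(n,s) has norm O(sqrt K).

   Put p(x) = limsup_n sup_s |a_(n,s)(x)| and N(x) = p(x) + dist(x, ell1). The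
   seminorm p is equivalent to the norm on the copy of ell1 and the distance
   vanishes there, so N is an equivalent norm. A Hahn-Banach argument transfers
   the estimate to the whole dual unit ball of N: each f in it has perturbations
   g_k in the ball with g_k(2 e_k) >= 1 and the same O(sqrt K) bound for the
   g_k - f. For finitely many F in X** almost attained at functionals f_F, some
   k therefore makes all F(g_(F,k) - f_F) small, and y = 2 e_k satisfies
   |F + y| >= (F + y)(g_(F,k)) >= |F| + 1 - d. *)
From HB Require Import structures.
Require Import Defs.
From mathcomp Require Import all_boot all_order all_algebra.
From mathcomp Require Import all_classical all_reals all_analysis.
From mathcomp Require Import ring lra.

Set Implicit Arguments.
Unset Strict Implicit.
Unset Printing Implicit Defensive.

Import Order.TTheory GRing.Theory Num.Theory.
Import numFieldNormedType.Exports.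

Local Open Scope classical_set_scope.
Local Open Scope ring_scope.

(** * Sublinear functionals and the Hahn-Banach theorem *)

Section hahn_banach.
Context {R : realType} {V : lmodType R}.
Implicit Types (p q : V -> R) (D : V -> R -> Prop).

Definition sublinear p : Prop :=
  (forall x y, p (x + y) <= p x + p y) /\
  (forall (t : R) x, 0 <= t -> p (t *: x) = t * p x).

Lemma sublinear0 p : sublinear p -> p 0 = 0.
Proof. by case=> _ /(_ 0 0 (lexx 0)); rewrite scale0r mul0r. Qed.

Lemma sublinear_geN p x : sublinear p -> - p (- x) <= p x.
Proof.
move=> sp; have := sp.1 x (- x); rewrite subrr (sublinear0 sp); lra.
Qed.

Lemma sublinearP p : (forall x y, p (x + y) <= p x + p y) ->
  (forall (t : R) x, 0 <= t -> p (t *: x) <= t * p x) -> sublinear p.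
Proof.
move=> pD pZ; split=> // t x; rewrite le_eqVlt => /predU1P[<-|t0].
  rewrite scale0r mul0r; apply/eqP; rewrite eq_le.
  have := pZ 0 0 (lexx 0); rewrite scale0r mul0r => ->/=.
  by have := pD 0 0; rewrite addr0; lra.
apply/eqP; rewrite eq_le (pZ _ _ (ltW t0))/= -ler_pdivlMl//.
have := pZ t^-1 (t *: x); rewrite scalerA mulVf ?gt_eqF// scale1r; apply.
by rewrite invr_ge0 ltW.
Qed.

Lemma sublinearD p q : sublinear p -> sublinear q -> sublinear (p \+ q).
Proof.
move=> [pD pZ] [qD qZ]; split=> [x y|t x t0] /=.
  by rewrite addrACA lerD.
by rewrite pZ// qZ// mulrDr.
Qed.

(** A pair [D y a] is read as a demand [a <= f y] on a functional [f] to be constructed; the closure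
    clauses add only demands that linearity of [f] already implies. The graph of a linear functional
    on a subspace is an instance. *)
Definition cone D : Prop := [/\ D 0 0,
  forall x y a b, D x a -> D y b -> D (x + y) (a + b) &
  forall (t : R) x a, 0 <= t -> D x a -> D (t *: x) (t * a)].

(* For [D = {(y, 0) | y in Y}] this is the quotient seminorm of [p] by [Y]. *)
Definition cone_infimum p D (x : V) : R :=
  inf [set r | exists y a, D y a /\ r = p (x + y) - a].

Section cone_infimum.
Variables (p : V -> R) (D : V -> R -> Prop).
Hypotheses (sp : sublinear p) (cD : cone D) (Dp : forall y a, D y a -> a <= p y).

Lemma cone_infimum_le x y a : D y a -> cone_infimum p D x <= p (x + y) - a.
Proof.
move=> Dya; apply: ge_inf; last by exists y, a.
(* The infimum is finite because [b <= p z <= p (x + z) + p (- x)]. *)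
exists (- p (- x)) => _ [z [b [Dzb ->]]].
have := sp.1 (x + z) (- x); rewrite addrAC subrr add0r => h.
by have := Dp Dzb; lra.
Qed.

Lemma cone_infimum_ltP x r : cone_infimum p D x < r ->
  exists y a, D y a /\ p (x + y) - a < r.
Proof.
have /inf_lt H : [set r | exists y a, D y a /\ r = p (x + y) - a] !=set0.
  by have [D0 _ _] := cD; exists (p (x + 0) - 0), 0, 0.
by move=> /H[_ [y [a [Dya ->]]] yar]; exists y, a.
Qed.

Lemma cone_infimum_sublinear : sublinear (cone_infimum p D).
Proof.
have [D0 DD DZ] := cD.
apply: sublinearP => [x y|t x t0].
  apply/ler_addgt0Pr => e e0.
  have [u [a [ua hu]]] : exists u a, D u a /\
      p (x + u) - a < cone_infimum p D x + e / 2.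
    by apply: cone_infimum_ltP; lra.
  have [v [b [vb hv]]] : exists u a, D u a /\
      p (y + u) - a < cone_infimum p D y + e / 2.
    by apply: cone_infimum_ltP; lra.
  have := cone_infimum_le (x + y) (DD _ _ _ _ ua vb).
  have := sp.1 (x + u) (y + v); rewrite addrACA; lra.
apply/ler_addgt0Pr => e e0.
(* Dividing by [t + 1] rather than [t] covers [t = 0]; multiplied by [t], the error is still at most
   [e]. *)
have [u [a [ua hu]]] : exists u a, D u a /\
    p (x + u) - a < cone_infimum p D x + e / (t + 1).
  by apply: cone_infimum_ltP; rewrite ltrDl divr_gt0//; lra.
have := cone_infimum_le (t *: x) (DZ _ _ _ t0 ua).
rewrite -scalerDr sp.2// -mulrBr => /le_trans; apply.
apply: (@le_trans _ _ (t * (cone_infimum p D x + e / (t + 1)))).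
  by rewrite ler_wpM2l// ltW.
rewrite mulrDr lerD2l mulrCA ger_pMr// ler_pdivrMr; lra.
Qed.

Lemma cone_infimum_le_id x : cone_infimum p D x <= p x.
Proof.
by have [D0 _ _] := cD; have := cone_infimum_le x D0; rewrite addr0 subr0.
Qed.

(** This is how domination by [cone_infimum] enforces a demand: a linear [f] below it satisfies
    [- f y = f (- y) <= - a]. *)
Lemma cone_infimumN y a : D y a -> cone_infimum p D (- y) <= - a.
Proof.
by move=> /(cone_infimum_le (- y)); rewrite addNr (sublinear0 sp) sub0r.
Qed.

End cone_infimum.

Lemma minimal_sublinear_scalar p : sublinear p ->
  (forall q, sublinear q -> (forall x, q x <= p x) -> q = p) -> scalar p.
Proof.
move=> sp pmin.
(* [D] is the ray through [(x, p x)]; minimality forces [cone_infimum p D = p]. *)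
have pN x : p (- x) = - p x.
  pose D y a := exists2 t : R, 0 <= t & y = t *: x /\ a = t * p x.
  have cD : cone D.
    split=> [|_ _ _ _ [t t0 [-> ->]] [u u0 [-> ->]]|t _ _ t0 [u u0 [-> ->]]].
    - by exists 0 => //; rewrite scale0r mul0r.
    - by exists (t + u); rewrite ?addr_ge0// scalerDl mulrDl.
    - by exists (t * u); rewrite ?mulr_ge0// scalerA mulrA.
  have Dp y a : D y a -> a <= p y by move=> [t t0 [-> ->]]; rewrite sp.2.
  have eq := pmin _ (cone_infimum_sublinear sp cD Dp)
    (cone_infimum_le_id sp cD Dp).
  have Dx : D x (p x) by exists 1; rewrite // scale1r mul1r.
  have := cone_infimumN sp Dp Dx; rewrite eq.
  by have := sublinear_geN x sp; lra.
(* By oddness, subadditivity at [- x], [- y] is the reverse inequality. *)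
have pD x y : p (x + y) = p x + p y.
  have := sp.1 x y; have := sp.1 (- x) (- y).
  by rewrite -opprD !pN; lra.
move=> t x y; rewrite pD; congr (_ + _).
have [t0|/ltW t0] := leP 0 t; first exact: sp.2.
by rewrite -[t]opprK scaleNr pN sp.2 ?mulNr// oppr_ge0.
Qed.

(** Subadditivity comes from comparability: of two near-minimisers, one at [x] and one at [y], the
    pointwise smaller serves at both points. *)
Lemma chain_infimum_sublinear p (A : set (V -> R)) q0 : A q0 ->
  (forall q, A q -> sublinear q /\ forall x, q x <= p x) ->
  (forall q q', A q -> A q' ->
     (forall x, q x <= q' x) \/ (forall x, q' x <= q x)) ->
  let m x := inf [set q x | q in A] in
  sublinear m /\ forall q, A q -> forall x, m x <= q x.
Proof.
move=> Aq0 Asub Atot m.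
have mle q : A q -> forall x, m x <= q x.
  move=> Aq x; apply: ge_inf; last by exists q.
  exists (- p (- x)) => _ [q' Aq' <-].
  have [sq' q'p] := Asub _ Aq'.
  by have := sublinear_geN x sq'; have := q'p (- x); lra.
have mlt x r : m x < r -> exists2 q, A q & q x < r.
  have /inf_lt H : [set q x | q in A] !=set0 by exists (q0 x), q0.
  by move=> /H[_ [q Aq <-]]; exists q.
split=> //; apply: sublinearP => [x y|t x].
  apply/ler_addgt0Pr => e e0.
  have [q Aq qx] : exists2 q, A q & q x < m x + e / 2 by apply: mlt; lra.
  have [q' Aq' qy] : exists2 q, A q & q y < m y + e / 2 by apply: mlt; lra.
  have [sq _] := Asub _ Aq; have [sq' _] := Asub _ Aq'.
  have [qq'|q'q] := Atot _ _ Aq Aq'.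
    by have := mle _ Aq (x + y); have := sq.1 x y; have := qq' y; lra.
  by have := mle _ Aq' (x + y); have := sq'.1 x y; have := q'q x; lra.
move=> t0; apply/ler_addgt0Pr => e e0.
have [q Aq qx] : exists2 q, A q & q x < m x + e / (t + 1).
  by apply: mlt; rewrite ltrDl divr_gt0//; lra.
have [sq _] := Asub _ Aq.
apply: le_trans (mle _ Aq _) _; rewrite sq.2//.
apply: (@le_trans _ _ (t * (m x + e / (t + 1)))); first by rewrite ler_wpM2l// ltW.
rewrite mulrDr lerD2l mulrCA ger_pMr// ler_pdivrMr; lra.
Qed.

Lemma sublinear_ge_scalar p : sublinear p ->
  exists f : {scalar V}, forall x, f x <= p x.
Proof.
move=> sp.
pose T := {q : V -> R | sublinear q /\ forall x, q x <= p x}.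
(* The order is reversed, so a maximal element in Zorn's lemma is a minimal sublinear functional. *)
pose le_T (q q' : T) := `[< forall x, sval q' x <= sval q x >].
have [q|q q' q'' /asboolP qq' /asboolP q'q''|q q' /asboolP qq' /asboolP q'q|A Atot|
  [m [sm mp]] mmin] := @Zorn T le_T.
- exact/asboolP.
- by apply/asboolP => x; exact: le_trans (q'q'' x) (qq' x).
- case: q q' qq' q'q => [q hq] [q' hq'] /= qq' q'q.
  by apply: eq_exist; apply/funext => x; apply/eqP; rewrite eq_le qq' q'q.
- have [[q0 Aq0]|A0] := pselect (A !=set0); last first.
    exists (exist _ p (conj sp (fun=> lexx _))) => q Aq.
    by exfalso; apply: A0; exists q.
  have [||_ _ [q Aq <-] [q' Aq' <-]|] :=
      @chain_infimum_sublinear p [set sval q | q in A] (sval q0).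
  + by exists q0.
  + by move=> _ [q _ <-]; exact: (svalP q).
  + by have [/asboolP|/asboolP] := Atot _ _ Aq Aq'; [right|left].
  set m := fun x => _ => sm mle.
  have mp x : m x <= p x.
    by apply: le_trans (mle (sval q0) _ x) ((svalP q0).2 x); exists q0.
  exists (exist _ m (conj sm mp)) => q Aq; apply/asboolP => x.
  by apply: mle; exists q.
have lm : scalar m.
  apply: minimal_sublinear_scalar => // q sq qm.
  have qp x : q x <= p x by exact: le_trans (qm x) (mp x).
  by have /(_ (asboolT qm))/(congr1 sval) := mmin (exist _ q (conj sq qp)).
pose f : {scalar V} := HB.pack m (GRing.isLinear.Build R V R *%R m lm).
by exists f.
Qed.

Theorem hahn_banach_cone p D : sublinear p -> cone D ->
  (forall y a, D y a -> a <= p y) ->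
  exists f : {scalar V}, (forall x, f x <= p x) /\ forall y a, D y a -> a <= f y.
Proof.
move=> sp cD Dp.
have [f fp] := sublinear_ge_scalar (cone_infimum_sublinear sp cD Dp).
exists f; split=> [x|y a Dya].
  exact: le_trans (fp x) (cone_infimum_le_id sp cD Dp x).
have := le_trans (fp (- y)) (cone_infimumN sp Dp Dya).
by rewrite linearN/= lerN2.
Qed.

End hahn_banach.

(** * Upper limits of families of linear functionals *)

Section eventual_sup.
Context {R : realType} {V : lmodType R} {I : Type}.
Variable phi : nat -> I -> V -> R.

(** The limsup over [n] of the supremum over [i], written as the infimum of the eventual upper
    bounds that are uniform in [i]. *)
Definition eventual_sup (v : V) : R :=
  inf [set t | exists m, forall n i, (m <= n)%N -> phi n i v <= t].

Hypothesis phi_scalar : forall n i, scalar (phi n i).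
Hypothesis phi_bounded : forall v, exists M, forall n i, `|phi n i v| <= M.
Variable i0 : I.

Lemma eventual_sup_le v t m :
  (forall n i, (m <= n)%N -> phi n i v <= t) -> eventual_sup v <= t.
Proof.
move=> le_t; apply: ge_inf; last by exists m.
have [M phiM] := phi_bounded v.
exists (- M) => u [k le_u]; have := le_u k i0 (leqnn k).
by have := phiM k i0; rewrite ler_norml => /andP[+ _]; exact: le_trans.
Qed.

Lemma eventual_sup_ltP v t : eventual_sup v < t ->
  exists m, forall n i, (m <= n)%N -> phi n i v <= t.
Proof.
move=> /inf_lt[|u [m le_u] ut].
  have [M phiM] := phi_bounded v; exists M, 0%N => n i _.
  exact: le_trans (ler_norm _) (phiM n i).
by exists m => n i mn; exact: le_trans (le_u n i mn) (ltW ut).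
Qed.

Lemma eventual_sup_sublinear : sublinear eventual_sup.
Proof.
have phiZ n i a v : phi n i (a *: v) = a * phi n i v.
  have phi0 : phi n i 0 = 0.
    by have := phi_scalar n i (-1) 0 0; rewrite scaler0 addr0; lra.
  by have := phi_scalar n i a v 0; rewrite phi0 !addr0.
apply: sublinearP => [u v|t v t0]; apply/ler_addgt0Pr => e e0.
  have [m um] : exists m, forall n i, (m <= n)%N ->
      phi n i u <= eventual_sup u + e / 2.
    by apply: eventual_sup_ltP; lra.
  have [m' vm'] : exists m, forall n i, (m <= n)%N ->
      phi n i v <= eventual_sup v + e / 2.
    by apply: eventual_sup_ltP; lra.
  apply: (@eventual_sup_le _ _ (maxn m m')) => n i.
  rewrite geq_max => /andP[mn m'n].
  rewrite -[u]scale1r phi_scalar mul1r scale1r.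
  by have := um n i mn; have := vm' n i m'n; lra.
have [m vm] : exists m, forall n i, (m <= n)%N ->
    phi n i v <= eventual_sup v + e / (t + 1).
  by apply: eventual_sup_ltP; rewrite ltrDl divr_gt0//; lra.
apply: (@eventual_sup_le _ _ m) => n i mn; rewrite phiZ.
apply: (@le_trans _ _ (t * (eventual_sup v + e / (t + 1)))).
  by rewrite ler_wpM2l// vm.
rewrite mulrDr lerD2l mulrCA ger_pMr// ler_pdivrMr; lra.
Qed.

End eventual_sup.

(** * Biased coins *)

Section biased_coin.
Context {R : realType}.
Implicit Types (s : nat -> bool) (n k : nat).

Definition sgn (b : bool) : R := if b then 1 else -1.

Lemma sgnM b : sgn b * sgn b = 1.
Proof. by case: b; rewrite /sgn ?mulrNN mulr1. Qed.

(** Both values keep positive probability, so weights may be divided by; the mean of [sgn] under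
    [bias u] is [sgn u / 2]. *)
Definition bias (u v : bool) : R := if u == v then 3 / 4 else 1 / 4.

Definition weight n s (w : {ffun 'I_n -> bool}) : R :=
  \prod_(i < n) bias (s i) (w i).

Definition set_bit k (v : bool) s : nat -> bool :=
  fun i => if i == k then v else s i.

Lemma bias_gt0 u v : 0 < bias u v.
Proof. by rewrite /bias; case: ifP => _; lra. Qed.

Lemma sum_bias u : bias u true + bias u false = 1.
Proof. by rewrite /bias; case: u => /=; lra. Qed.

(** The sum is 1 when [u = v] and [9/4 + 1/12 = 7/3] otherwise. *)
Lemma bias_second_moment u v :
  bias v true * bias v true / bias u true +
  bias v false * bias v false / bias u false <= 7 / 3.
Proof. by rewrite /bias; case: u v => -[] /=; lra. Qed.

Lemma weight_gt0 n s (w : {ffun 'I_n -> bool}) : 0 < weight s w.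
Proof. by apply: prodr_gt0 => i _; exact: bias_gt0. Qed.

Lemma sum_prod_ffun n (F : 'I_n -> bool -> R) :
  \sum_(w : {ffun 'I_n -> bool}) \prod_i F i (w i) =
  \prod_i (F i true + F i false).
Proof.
rewrite -bigA_distr_bigA; apply: eq_bigr => i _.
by rewrite big_bool.
Qed.

Lemma sum_weight n s : \sum_(w : {ffun 'I_n -> bool}) weight s w = 1.
Proof.
rewrite (sum_prod_ffun (fun i b => bias (s i) b)) big1// => i _.
exact: sum_bias.
Qed.

Lemma sum_weight_sgn n s (k : 'I_n) :
  \sum_(w : {ffun 'I_n -> bool}) weight s w * sgn (w k) = sgn (s k) / 2.
Proof.
(* The sign is absorbed into the factor of coordinate [k]; every other factor sums to 1. *)
pose F (i : 'I_n) b := bias (s i) b * (if i == k then sgn b else 1).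
transitivity (\sum_(w : {ffun 'I_n -> bool}) \prod_i F i (w i)).
  apply: eq_bigr => w _; rewrite /F big_split/=; congr (_ * _).
  by rewrite -big_mkcond/= big_pred1_eq.
rewrite sum_prod_ffun (bigD1 k)//= big1 ?mulr1 => [|i /negPf ik].
  by rewrite /F eqxx /bias /sgn; case: (s k) => /=; lra.
by rewrite /F ik !mulr1 sum_bias.
Qed.

(** The ratio [D k w / weight s w] depends at most on [w k] and has mean 0 under [weight s];
    coordinates are independent, so distinct ratios are orthogonal. On the diagonal the bound is the
    second moment [7/3] minus 1. *)
Lemma set_bit_orthogonal n s j k v :
  let D i (w : {ffun 'I_n -> bool}) := weight (set_bit i v s) w - weight s w in
  if j == k then (\sum_w D j w * D k w / weight s w <= 4 / 3 : Prop)
  else \sum_w D j w * D k w / weight s w = 0.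
Proof.
move=> D.
pose F (i : 'I_n) b :=
  bias (set_bit j v s i) b * bias (set_bit k v s i) b / bias (s i) b.
have -> : \sum_w D j w * D k w / weight s w =
    \prod_i (F i true + F i false) - 1.
  rewrite -sum_prod_ffun -[in RHS](sum_weight n s) -sumrB.
  transitivity (\sum_(w : {ffun 'I_n -> bool}) (\prod_i F i (w i) -
      weight (set_bit j v s) w - weight (set_bit k v s) w + weight s w)).
    apply: eq_bigr => w _; rewrite /F !big_split/= prodfV.
    rewrite -!/(weight _ w) /D.
    by have /gt_eqF/negbT W0 := weight_gt0 s w; field.
  rewrite big_split/= !sumrB !sum_weight; ring.
have F1 (i : 'I_n) : (i != j :> nat) || (i != k :> nat) ->
    F i true + F i false = 1.
  have bias0 u b : bias u b != 0 by rewrite gt_eqF// bias_gt0.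
  rewrite /F /set_bit => /orP[] /negPf ->.
    by rewrite ![bias (s i) _ * _]mulrC !mulfK// sum_bias.
  by rewrite !mulfK// sum_bias.
have [jk|jk] := eqVneq j k; last first.
  rewrite big1 ?subrr// => i _; apply: F1.
  by have [ij|//] := eqVneq (i : nat) j; rewrite ij jk.
rewrite -{k}jk in F F1 *.
(* A bit at position [j >= n] is invisible to words of length [n], so the sum is then 0. *)
have [jn|nj] := ltnP j n; last first.
  rewrite big1 ?subrr; first by lra.
  by move=> i _; apply: F1; rewrite orbb ltn_eqF// (leq_trans (ltn_ord i)).
rewrite (bigD1 (Ordinal jn))//= big1 ?mulr1 => [|i ij]; last first.
  by apply: F1; rewrite orbb; apply: contra ij => /eqP ij; apply/eqP/val_inj.
by rewrite /F /set_bit/= eqxx; have := bias_second_moment (s j) v; lra.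
Qed.

(** Orthogonality bounds the squared L2 norm of a signed sum of [L ^ 2] increments by
    [L ^ 2 * (4 / 3)], and the L1 norm is controlled by the L2 norm. Taking a square number of terms
    avoids square roots. *)
Lemma sum_weight_set_bit n s L (eps : 'I_(L ^ 2) -> bool) v : (0 < L)%N ->
  \sum_(w : {ffun 'I_n -> bool}) `|\sum_k sgn (eps k) *
      (weight (set_bit k v s) w - weight s w)| <= 2 * L%:R.
Proof.
move=> L0; pose l : R := L%:R; have l0 : 0 < l by rewrite ltr0n.
pose D (k : 'I_(L ^ 2)) (w : {ffun 'I_n -> bool}) :=
  weight (set_bit k v s) w - weight s w.
pose S w := \sum_k sgn (eps k) * D k w.
have second_moment : \sum_w S w ^+ 2 / weight s w <= l ^+ 2 * (4 / 3).
  have -> : \sum_w S w ^+ 2 / weight s w = \sum_j \sum_k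
      sgn (eps j) * sgn (eps k) * \sum_w D j w * D k w / weight s w.
    transitivity (\sum_w \sum_j \sum_k
        sgn (eps j) * sgn (eps k) * (D j w * D k w / weight s w)).
      apply: eq_bigr => w _; rewrite expr2 mulr_suml mulr_suml.
      apply: eq_bigr => j _; rewrite mulr_sumr mulr_suml.
      by apply: eq_bigr => k _; ring.
    rewrite exchange_big; apply: eq_bigr => j _.
    rewrite exchange_big; apply: eq_bigr => k _.
    by rewrite mulr_sumr.
  have -> : l ^+ 2 * (4 / 3) = \sum_(j < L ^ 2) 4 / 3.
    by rewrite sumr_const card_ord -[RHS]mulr_natl natrX.
  apply: ler_sum => j _; rewrite (bigD1 j)//= [X in _ + X]big1 ?addr0 => [|k kj].
    by have := @set_bit_orthogonal n s j j v; rewrite eqxx sgnM mul1r.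
  have /= := @set_bit_orthogonal n s j k v.
  by rewrite eq_sym ifN// => ->; rewrite mulr0.
(* Cauchy-Schwarz in L2([weight s]), linearised with parameter [l]. *)
have amgm w : `|S w| <= (l * weight s w + l^-1 * (S w ^+ 2 / weight s w)) / 2.
  have W0 := weight_gt0 s w.
  have lW : 0 < l * weight s w by rewrite mulr_gt0.
  rewrite -subr_ge0 -[S w ^+ 2]real_normK ?num_real//.
  have -> : (l * weight s w + l^-1 * (`|S w| ^+ 2 / weight s w)) / 2 - `|S w| =
    (l * weight s w - `|S w|) ^+ 2 / (l * weight s w) / 2.
    by field; rewrite !gt_eqF.
  by rewrite !divr_ge0 ?sqr_ge0// ltW.
(* The total is at most [(l + l * (4 / 3)) / 2], that is, 7/6 of [l]. *)
apply: le_trans (ler_sum _ (fun w _ => amgm w)) _.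
rewrite -mulr_suml big_split/= -!mulr_sumr sum_weight.
have : l^-1 * (\sum_w S w ^+ 2 / weight s w) <= l * (4 / 3).
  by rewrite ler_pdivrMl// mulrA -expr2.
by rewrite -/l; lra.
Qed.

End biased_coin.

(** * The renorming *)

Section seminorm.
Context {R : realType}.

Lemma sublinear_norm (X : normedModType R) : sublinear (fun x : X => `|x|).
Proof.
split=> [x y|t x t0]; first exact: ler_normD.
by rewrite normrZ ger0_norm.
Qed.

Lemma sublinear_even_normZ (V : lmodType R) (p : V -> R) : sublinear p ->
  (forall x, p (- x) <= p x) -> forall a x, p (a *: x) = `|a| * p x.
Proof.
move=> [_ pZ] pN a x.
have {}pN : p (- x) = p x.
  by apply/eqP; rewrite eq_le pN/= -[leLHS](congr1 p (opprK x)) pN.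
have [a0|a0] := leP 0 a; first by rewrite pZ// ger0_norm.
rewrite ltr0_norm// -[in RHS]pN -pZ ?scaleNr ?scalerN ?opprK//.
by rewrite oppr_ge0 ltW.
Qed.

End seminorm.

(** * Unit vectors and partial sums in [ell1] *)

Section ell1_unit.
Context {R : realType}.

Lemma ell1_unit_subproof k :
  (fun i => (i == k)%:R : R^o) \in @is_ell1 R.
Proof.
apply/is_ell1P; apply: nondecreasing_is_cvgn.
  by apply/nondecreasing_seqP => n; rewrite seriesSr lerDl.
exists 1 => _ [n _ <-]; rewrite /series/=.
rewrite (eq_bigr (fun i => if i == k then 1 else 0)) => [|i _]; last first.
  by case: (i == k); rewrite ?normr1 ?normr0.
rewrite -big_mkcond big_mkord /=.
have [kn|nk] := ltnP k n.
  by rewrite (big_pred1 (Ordinal kn)).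
rewrite big1 ?ler01// => i /eqP ik.
by have := ltn_ord i; rewrite ik ltnNge nk.
Qed.

Definition ell1_unit k : ell1 R := Ell1 (ell1_unit_subproof k).

Lemma sum_ell1_unit k n (a : 'I_n -> R) (kn : (k < n)%N) :
  \sum_(i < n) ell1_unit k i * a i = a (Ordinal kn).
Proof.
rewrite (bigD1 (Ordinal kn))//= eqxx mul1r big1 ?addr0// => i ik.
by rewrite (negPf (_ : (i : nat) != k)) ?mul0r.
Qed.

Lemma ell1_partial_sum_le (u : ell1 R) n : \sum_(i < n) `|u i| <= `|u|.
Proof.
have nd : nondecreasing_seq (series (fun n => `|u n| : R)).
  by apply/nondecreasing_seqP => k; rewrite seriesSr lerDl.
by have := nondecreasing_cvgn_le nd (@ell1_cvg R u) n; rewrite /series/= big_mkord.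
Qed.

Lemma ell1_norm_le (u : ell1 R) M :
  (forall n, \sum_(i < n) `|u i| <= M) -> `|u| <= M.
Proof.
move=> uM; apply: limr_le; first exact: ell1_cvg.
by apply: nearW => n; rewrite /series/= big_mkord.
Qed.

End ell1_unit.

(** * Functionals with prescribed signs on the copy of [ell1] *)

Section sign_functional.
Context {R : realType} {X : normedModType R}.
Variables (T : {linear ell1 R -> X}) (c : R).
Hypotheses (c0 : 0 < c) (cT : forall u, c * `|u| <= `|T u|).

Lemma sign_functional n (w : {ffun 'I_n -> bool}) : exists z : {scalar X},
  (forall x, `|z x| <= c^-1 * `|x|) /\
  (forall u, z (T u) = \sum_(i < n) u i * sgn (w i)).
Proof.
pose p (x : X) := c^-1 * `|x|.
have sp : sublinear p.
  split=> [x y|t x t0]; rewrite /p.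
    by rewrite -mulrDr ler_wpM2l ?ler_normD// invr_ge0 ltW.
  by rewrite normrZ ger0_norm// mulrCA.
pose S (u : ell1 R) := \sum_(i < n) u i * sgn (w i).
have SD u v : S (u + v) = S u + S v.
  by rewrite /S -big_split; apply: eq_bigr => i _; exact: mulrDl.
have SZ t u : S (t *: u) = t * S u.
  by rewrite /S mulr_sumr; apply: eq_bigr => i _; rewrite mulrA.
(* The graph of [T u |-> S u]; it is dominated by [p] since [S u <= |u| <= c^-1 * |T u|]. *)
pose D x a := exists u, x = T u /\ a = S u.
have cD : cone D.
  split=> [|_ _ _ _ [u [-> ->]] [v [-> ->]]|t _ _ t0 [u [-> ->]]].
  - by exists 0; rewrite linear0 -[X in S X](scale0r 0) SZ mul0r.
  - by exists (u + v); rewrite linearD SD.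
  - by exists (t *: u); rewrite linearZ SZ.
have [y _ [u [-> ->]]|z [zp Dz]] := hahn_banach_cone sp cD.
  apply: (@le_trans _ _ `|u|); last by rewrite ler_pdivlMl.
  apply: le_trans (ell1_partial_sum_le u n); apply: ler_sum => i _.
  apply: le_trans (ler_norm _) _; rewrite normrM ler_piMr//.
  by case: (w i); rewrite /= ?normrN normr1.
exists z; split=> [x|u].
  rewrite ler_norml zp andbT lerNl -linearN.
  by apply: le_trans (zp _) _; rewrite /p normrN.
apply/eqP; rewrite eq_le; apply/andP; split.
  have : S (- u) <= z (T (- u)) by apply: Dz; exists (- u).
  by rewrite !linearN/= -scaleN1r SZ mulN1r lerN2.
by apply: Dz; exists u.
Qed.

End sign_functional.

Section sign_averages.
Context {R : realType} {X : normedModType R}.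
Variables (T : {linear ell1 R -> X}) (c : R).
Variable z : forall n, {ffun 'I_n -> bool} -> {scalar X}.
Hypotheses (c0 : 0 < c)
  (z_le : forall n (w : {ffun 'I_n -> bool}) x, `|z w x| <= c^-1 * `|x|)
  (zT : forall n (w : {ffun 'I_n -> bool}) u,
    z w (T u) = \sum_(i < n) u i * sgn (w i)).

Definition average n (s : nat -> bool) (x : X) : R :=
  \sum_(w : {ffun 'I_n -> bool}) weight s w * z w x.

Lemma average_scalar n s : scalar (average n s).
Proof.
move=> a x y; rewrite /average mulr_sumr -big_split; apply: eq_bigr => w _.
by rewrite linearP/=; ring.
Qed.

Lemma average0 n s : average n s 0 = 0.
Proof. by rewrite /average big1// => w _; rewrite linear0 mulr0. Qed.

Lemma averageZ n s a x : average n s (a *: x) = a * average n s x.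
Proof. by rewrite -[_ *: _]addr0 average_scalar average0 addr0. Qed.

Lemma averageT n s u :
  average n s (T u) = 2^-1 * \sum_(i < n) u i * sgn (s i).
Proof.
rewrite /average.
transitivity (\sum_(i < n) u i *
    \sum_(w : {ffun 'I_n -> bool}) weight s w * sgn (w i)).
  under eq_bigr do rewrite zT mulr_sumr.
  rewrite exchange_big; apply: eq_bigr => i _; rewrite mulr_sumr.
  by apply: eq_bigr => w _; rewrite mulrCA.
rewrite mulr_sumr; apply: eq_bigr => i _.
by rewrite sum_weight_sgn; ring.
Qed.

Lemma averageT_unit n s k : (k < n)%N ->
  average n s (T (ell1_unit k)) = sgn (s k) / 2.
Proof. by move=> kn; rewrite averageT sum_ell1_unit/= mulrC. Qed.

Lemma weighted_sum_le n (g : {ffun 'I_n -> bool} -> R) x :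
  `|\sum_w g w * z w x| <= (\sum_w `|g w|) * (c^-1 * `|x|).
Proof.
apply: le_trans (ler_norm_sum _ _ _) _; rewrite mulr_suml.
by apply: ler_sum => w _; rewrite normrM ler_wpM2l.
Qed.

Lemma average_le n s x : `|average n s x| <= c^-1 * `|x|.
Proof.
apply: le_trans (weighted_sum_le _ _) _.
rewrite (eq_bigr (weight s)) ?sum_weight ?mul1r// => w _.
by rewrite gtr0_norm// weight_gt0.
Qed.

(** The signed sum is a combination of the [z w], each of norm at most [c^-1], and
    [sum_weight_set_bit] bounds the sum of the absolute values of its coefficients. *)
Lemma average_set_bit n s L (eps : 'I_(L ^ 2) -> bool) v x : (0 < L)%N ->
  `|\sum_k sgn (eps k) * (average n (set_bit k v s) x - average n s x)| <=
  2 * L%:R * (c^-1 * `|x|).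
Proof.
move=> L0.
have -> : \sum_k sgn (eps k) * (average n (set_bit k v s) x - average n s x) =
    \sum_(w : {ffun 'I_n -> bool}) (\sum_k sgn (eps k) *
      (weight (set_bit k v s) w - weight s w)) * z w x.
  under [RHS]eq_bigr do rewrite mulr_suml.
  rewrite [RHS]exchange_big; apply: eq_bigr => k _.
  rewrite -sumrB mulr_sumr; apply: eq_bigr => w _; ring.
apply: le_trans (weighted_sum_le _ _) _; rewrite ler_wpM2r ?sum_weight_set_bit//.
by rewrite mulr_ge0// invr_ge0 ltW.
Qed.

(** The sign is part of the index, so that the supremum over indices is one of absolute values and
    the limsup is even. *)
Definition signed_average n (i : (nat -> bool) * bool) (x : X) : R :=
  sgn i.2 * average n i.1 x.

Lemma signed_average_scalar n i : scalar (signed_average n i).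
Proof. by move=> a x y; rewrite /signed_average average_scalar; ring. Qed.

Lemma norm_sgn b : `|sgn b| = 1 :> R.
Proof. by case: b; rewrite /= ?normrN normr1. Qed.

Lemma signed_average_le n i x : `|signed_average n i x| <= c^-1 * `|x|.
Proof. by rewrite normrM norm_sgn mul1r average_le. Qed.

Definition limsup_average : X -> R := eventual_sup signed_average.

Let signed_average_bounded x :
  exists M, forall n i, `|signed_average n i x| <= M.
Proof. by exists (c^-1 * `|x|) => n i; exact: signed_average_le. Qed.

Let i0 : (nat -> bool) * bool := (xpredT, true).

Lemma limsup_average_sublinear : sublinear limsup_average.
Proof.
exact: eventual_sup_sublinear signed_average_scalar signed_average_bounded i0.
Qed.

Lemma limsup_averageN x : limsup_average (- x) <= limsup_average x.
Proof.
apply/ler_addgt0Pr => e e0.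
have [m mx] : exists m, forall n i, (m <= n)%N ->
    signed_average n i x <= limsup_average x + e.
  by apply: eventual_sup_ltP => //; rewrite ltrDl.
apply: (@eventual_sup_le _ _ _ _ signed_average_bounded i0 _ _ m) => n [s b] mn.
have := mx n (s, ~~ b) mn.
by rewrite /signed_average -scaleN1r averageZ/=; case: b; rewrite /sgn/=; lra.
Qed.

Lemma limsup_average_le x : limsup_average x <= c^-1 * `|x|.
Proof.
apply: (@eventual_sup_le _ _ _ _ signed_average_bounded i0 _ _ 0%N) => n i _.
exact: le_trans (ler_norm _) (signed_average_le _ _ _).
Qed.

Lemma limsup_average_unit k : limsup_average (2 *: T (ell1_unit k)) <= 1.
Proof.
(* Words of length [n] contain bit [k] only when [n > k]; from there on the value is exactly 1 or
   -1. *)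
apply: (@eventual_sup_le _ _ _ _ signed_average_bounded i0 _ _ k.+1) => n [s b] kn.
rewrite /signed_average averageZ averageT_unit//=.
by case: b (s k) => -[]; rewrite /sgn; lra.
Qed.

Lemma limsup_average_ge u : `|u| <= 2 * limsup_average (T u).
Proof.
apply: ell1_norm_le => m; apply/ler_addgt0Pr => e e0.
have [m' mu] : exists m, forall n i, (m <= n)%N ->
    signed_average n i (T u) <= limsup_average (T u) + e / 2.
  by apply: eventual_sup_ltP => //; rewrite ltrDl; lra.
(* Choosing [s] as the sign pattern of [u] turns the average at [T u] into half of a partial sum of
   the norm of [u]. *)
have := mu (maxn m m') (fun i => 0 <= u i, true) (leq_maxr _ _).
rewrite /signed_average/= mul1r averageT.
have -> : \sum_(i < maxn m m') u i * sgn (0 <= u i) =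
    \sum_(i < maxn m m') `|u i|.
  apply: eq_bigr => i _; rewrite /sgn.
  by case: leP => [u0|/ltW u0]; [rewrite ger0_norm ?mulr1|rewrite ler0_norm ?mulrN1].
have : \sum_(i < m) `|u i| <= \sum_(i < maxn m m') `|u i|.
  rewrite -!(big_mkord xpredT (fun i => `|u i|)).
  rewrite (big_cat_nat (leq0n m) (leq_maxl m m'))/= lerDl.
  by apply: sumr_ge0.
lra.
Qed.

End sign_averages.

(** * The equivalent norm and perturbations in its dual ball *)

Section renorming_ell1.
Context {R : realType} {X : normedModType R}.
Variables (T : {linear ell1 R -> X}) (c C : R).
Variable z : forall n, {ffun 'I_n -> bool} -> {scalar X}.
Hypotheses (c0 : 0 < c) (C0 : 0 < C)
  (z_le : forall n (w : {ffun 'I_n -> bool}) x, `|z w x| <= c^-1 * `|x|)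
  (zT : forall n (w : {ffun 'I_n -> bool}) u,
    z w (T u) = \sum_(i < n) u i * sgn (w i))
  (TC : forall u, `|T u| <= C * `|u|).

Let p : X -> R := limsup_average z.
Let sp : sublinear p := limsup_average_sublinear z_le.

Let cone_range : cone (fun (y : X) (a : R) => range T y /\ a = 0).
Proof.
split=> [|_ _ _ _ [[u _ <-] ->] [[v _ <-] ->]|t _ _ t0 [[u _ <-] ->]].
- by split=> //; exists 0; rewrite // linear0.
- by rewrite addr0; split=> //; exists (u + v); rewrite // linearD.
- by rewrite mulr0; split=> //; exists (t *: u); rewrite // linearZ.
Qed.

Definition dist_range : X -> R :=
  cone_infimum (fun x => `|x|) (fun y a => range T y /\ a = 0).

Let range_ge0 (y : X) (a : R) : range T y /\ a = 0 -> a <= `|y|.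
Proof. by case=> _ ->. Qed.

Lemma dist_range_sublinear : sublinear dist_range.
Proof. exact: cone_infimum_sublinear (@sublinear_norm _ X) cone_range range_ge0. Qed.

Lemma dist_range_ltP x r : dist_range x < r -> exists u, `|x + T u| < r.
Proof.
move=> /(cone_infimum_ltP cone_range)[_ [_ [[[u _ <-] ->]]]].
by rewrite subr0; exists u.
Qed.

Lemma dist_range_le x u : dist_range x <= `|x + T u|.
Proof.
rewrite -[leRHS]subr0.
apply: (cone_infimum_le (@sublinear_norm _ X) range_ge0).
by split=> //; exists u.
Qed.

Lemma dist_rangeN x : dist_range (- x) <= dist_range x.
Proof.
apply/ler_addgt0Pr => e e0.
have [u /ltW xu] : exists u, `|x + T u| < dist_range x + e.
  by apply: dist_range_ltP; rewrite ltrDl.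
apply: le_trans xu; rewrite -normrN opprD -linearN; exact: dist_range_le.
Qed.

Lemma dist_range_le_norm x : dist_range x <= `|x|.
Proof. by have := dist_range_le x 0; rewrite linear0 addr0. Qed.

Lemma dist_rangeT u : dist_range (T u) <= 0.
Proof. by have := dist_range_le (T u) (- u); rewrite linearN subrr normr0. Qed.

Let even_ge0 (q : X -> R) x : sublinear q -> (forall x, q (- x) <= q x) -> 0 <= q x.
Proof. by move=> sq qN; have := sublinear_geN x sq; have := qN x; lra. Qed.

Definition ell1_renorm (x : X) : R := p x + dist_range x.

Lemma ell1_renorm_sublinear : sublinear ell1_renorm.
Proof. exact: sublinearD sp dist_range_sublinear. Qed.

Lemma ell1_renormN x : ell1_renorm (- x) <= ell1_renorm x.
Proof. by apply: lerD; [exact: limsup_averageN z_le _|exact: dist_rangeN]. Qed.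

Lemma ell1_renorm_le x : ell1_renorm x <= (c^-1 + 1) * `|x|.
Proof.
rewrite mulrDl mul1r lerD ?dist_range_le_norm//; exact: limsup_average_le.
Qed.

(** Choose [u] with [|x + T u|] close to [dist_range x]. Then [|T u| <= 2 * C * p (T u)] and
    [p (T u) <= c^-1 * |x + T u| + p x], so [|x|] is at most [(1 + 2 * (C / c)) * |x + T u| + 2 * C
    * p x]. *)
Lemma ell1_renorm_ge x : `|x| <= (1 + 2 * C + 2 * (C / c)) * ell1_renorm x.
Proof.
set K := 1 + _ + _.
have Cc : 0 < C / c by rewrite divr_gt0.
have C0' := C0.
have K0 : 0 < K by rewrite /K; lra.
apply/ler_addgt0Pr => e e0.
have [u xu] : exists u, `|x + T u| < dist_range x + e / K.
  by apply: dist_range_ltP; rewrite ltrDl divr_gt0.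
have p0 : 0 <= p x by apply: even_ge0 => // y; exact: limsup_averageN z_le _.
have q0 : 0 <= dist_range x.
  by apply: even_ge0 dist_range_sublinear _; exact: dist_rangeN.
have pTu : p (T u) <= c^-1 * `|x + T u| + p x.
  have := sp.1 (x + T u) (- x); rewrite addrAC subrr add0r.
  have := limsup_averageN z_le x; rewrite -/p => h1 h2.
  by have := limsup_average_le z_le (x + T u); rewrite -/p; lra.
have Tu : `|T u| <= 2 * C * p (T u).
  apply: le_trans (TC u) _; rewrite [2 * C]mulrC -mulrA ler_pM2l//.
  exact: limsup_average_ge.
have xT : `|x| <= `|x + T u| + `|T u|.
  by rewrite -[x in leLHS](addrK (T u)) ler_normB.
have : 2 * C * p (T u) <= 2 * C * (c^-1 * `|x + T u| + p x).
  by rewrite ler_wpM2l// mulr_ge0// ltW.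
have -> : 2 * C * (c^-1 * `|x + T u| + p x) =
  2 * (C / c) * `|x + T u| + 2 * C * p x by ring.
have eK : K * (e / K) = e by rewrite mulrC divfK ?gt_eqF.
have : K * `|x + T u| <= K * (dist_range x + e / K) by rewrite ler_pM2l// ltW.
rewrite mulrDr eK /ell1_renorm mulrDr.
have : (1 + 2 * (C / c)) * `|x + T u| <= K * `|x + T u|.
  by rewrite ler_wpM2r// /K; lra.
have : 2 * C * p x <= K * p x by rewrite ler_wpM2r// /K; lra.
by nra.
Qed.

(** Kept transparent, so that the norm of the renormed space is convertible to [ell1_renorm]. *)
Definition ell1_equivalent_norm : equivalent_norm X.
Proof.
apply: (@EquivalentNorm _ _ ell1_renorm).
- exact: ell1_renorm_sublinear.1.
- exact: sublinear_even_normZ ell1_renorm_sublinear ell1_renormN.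
- move=> x x0; apply/eqP; rewrite -normr_le0.
  by have := ell1_renorm_ge x; rewrite x0 mulr0.
- have K0 : 0 < 1 + 2 * C + 2 * (C / c).
    by rewrite !addr_gt0// !mulr_gt0// invr_gt0.
  exists (1 + 2 * C + 2 * (C / c))^-1, (c^-1 + 1).
  split=> [|x]; first by rewrite invr_gt0.
  by rewrite ell1_renorm_le ler_pdivrMl// ell1_renorm_ge.
Defined.

Lemma ell1_renorm_unit k : ell1_renorm (2 *: T (ell1_unit k)) <= 1.
Proof.
rewrite -[leRHS]addr0 lerD//; first exact: (limsup_average_unit z_le zT).
by rewrite -linearZ dist_rangeT.
Qed.

(* The pair [(x, 0)] carries [f]; a Hahn-Banach extension [G] of it dominated by
   the limsup of [a_s(v0) + sum_k a_(set_bit k s)(v_k)] splits into [f] and the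
   [g k]. Each inequality satisfied by the averages [a_s] thus passes to [f] and
   [g] without writing [f] as a weak-star limit of averages. *)
Lemma perturbed_functionals (f : {scalar X}) L : (0 < L)%N ->
  (forall x, f x <= ell1_renorm x) ->
  exists g : 'I_(L ^ 2) -> {scalar X},
  [/\ forall k x, g k x <= ell1_renorm x,
      forall k, 1 <= g k (2 *: T (ell1_unit k)) &
      forall (eps : 'I_(L ^ 2) -> bool) x,
        \sum_k sgn (eps k) * (g k x - f x) <= 2 * L%:R * (c^-1 * `|x|)].
Proof.
move=> L0 fN.
pose V : lmodType R := (X * {ffun 'I_(L ^ 2) -> X})%type.
(* The boolean [i.2] is both the overall sign and the value written into bit [k]; the two signs
   cancel at [ell1_unit k], which makes [g k] positive there whatever the index. *)
pose psi n (i : (nat -> bool) * bool) (v : V) : R := sgn i.2 *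
  (average z n i.1 v.1 + \sum_(k < L ^ 2) average z n (set_bit k i.2 i.1) (v.2 k)).
have psi_scalar n i : scalar (psi n i).
  move=> a u v; rewrite /psi average_scalar.
  under eq_bigr do rewrite !ffunE average_scalar.
  by rewrite big_split/= -mulr_sumr; ring.
have psi_bounded v : exists M, forall n i, `|psi n i v| <= M.
  exists (c^-1 * `|v.1| + \sum_k c^-1 * `|v.2 k|) => n i.
  rewrite normrM norm_sgn mul1r (le_trans (ler_normD _ _))// lerD//.
    exact: average_le.
  apply: le_trans (ler_norm_sum _ _ _) _; apply: ler_sum => k _.
  exact: average_le.
have i0 : (nat -> bool) * bool := (xpredT, true).
have phi_bounded x : exists M, forall n i, `|signed_average z n i x| <= M.
  by exists (c^-1 * `|x|) => n i; exact: signed_average_le.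
(* Applying the distance to the sum of all coordinates gives [dist_range x] when [x] sits in a
   single coordinate, and 0 when the coordinates cancel. *)
pose total (v : V) := v.1 + \sum_k v.2 k.
pose P (v : V) := eventual_sup psi v + dist_range (total v).
have sP : sublinear P.
  apply: sublinearD (eventual_sup_sublinear psi_scalar psi_bounded i0) _.
  have [qD qZ] := dist_range_sublinear.
  split=> [u v|t v t0]; rewrite /total/=.
    under eq_bigr do rewrite ffunE.
    by rewrite big_split addrACA qD.
  under eq_bigr do rewrite ffunE.
  by rewrite -scaler_sumr -scalerDr qZ.
pose D (v : V) a := exists x, v = (x, 0) /\ a = f x.
have cD : cone D.
  split=> [|_ _ _ _ [x [-> ->]] [y [-> ->]]|t _ _ t0 [x [-> ->]]].
  - by exists 0; rewrite linear0.
  - by exists (x + y); rewrite linearD; split=> //; congr (_, _); rewrite addr0.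
  - by exists (t *: x); rewrite linearZ; split=> //; congr (_, _); rewrite scaler0.
have DP v a : D v a -> a <= P v.
  move=> [x [-> ->]]; apply: le_trans (fN x) _.
  rewrite /P /total/= big1 ?addr0 => [|k _]; last by rewrite ffunE.
  rewrite lerD2r; apply/ler_addgt0Pr => e e0.
  have [m hm] : exists m, forall n i, (m <= n)%N ->
      psi n i (x, 0) <= eventual_sup psi (x, 0) + e.
    by apply: eventual_sup_ltP => //; rewrite ltrDl.
  apply: (eventual_sup_le phi_bounded i0 (m := m)) => n i mn.
  apply: le_trans (hm n i mn); rewrite /psi /= big1 ?addr0// => k _.
  by rewrite ffunE average0.
have [G [GP DG]] := hahn_banach_cone sP cD DP.
have G0 x : G (x, 0) = f x.
  apply/eqP; rewrite eq_le; apply/andP; split; last by apply: DG; exists x.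
  have : f (- x) <= G (- x, 0) by apply: DG; exists (- x).
  have -> : (- x, 0) = - (x, 0) :> V by congr (_, _); rewrite oppr0.
  by rewrite !linearN lerN2.
pose inj k x : V := (0, [ffun j => if j == k then x else 0]).
have inj_scalar k : scalar (fun x => G (inj k x)).
  move=> a x y; rewrite -linearP; congr (G _); congr (_, _).
    by rewrite /= scaler0 addr0.
  by apply/ffunP => j; rewrite !ffunE; case: ifP => // _; rewrite scaler0 addr0.
pose g k : {scalar X} := HB.pack (fun x => G (inj k x))
  (GRing.isLinear.Build R X R *%R _ (inj_scalar k)).
have psi_inj n i k x : psi n i (inj k x) =
    signed_average z n (set_bit k i.2 i.1, i.2) x.
  rewrite /psi average0 add0r (bigD1 k)//= ffunE eqxx big1 ?addr0// => j jk.
  by rewrite ffunE (negPf jk) average0.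
have total_inj k x : total (inj k x) = x.
  rewrite /total add0r (bigD1 k)//= ffunE eqxx big1 ?addr0// => j jk.
  by rewrite ffunE (negPf jk).
exists g; split=> [k x|k|eps x].
- apply: le_trans (GP _) _; rewrite /P total_inj lerD2r.
  apply/ler_addgt0Pr => e e0.
  have [m hm] : exists m, forall n i, (m <= n)%N ->
      signed_average z n i x <= p x + e.
    by apply: eventual_sup_ltP => //; rewrite ltrDl.
  apply: (eventual_sup_le psi_bounded i0 (m := m)) => n i mn.
  rewrite psi_inj; exact: (hm n (_, _) mn).
(* Domination by [P] bounds [G] from above only, so the lower bound is read off at the opposite
   vector, where [psi] equals -1 for [n > k]. *)
- suff : g k (- (2 *: T (ell1_unit k))) <= - 1 by rewrite linearN lerN2.
  apply: le_trans (GP _) _; rewrite /P total_inj -[leRHS]addr0 lerD//; last first.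
    by rewrite -linearZ -linearN dist_rangeT.
  apply: (eventual_sup_le psi_bounded i0 (m := k.+1)) => n [s b] kn.
  rewrite psi_inj /signed_average -scaleNr averageZ (averageT_unit zT)//.
  rewrite /= /set_bit eqxx; have := @sgnM R b; rewrite mulrCA; lra.
- pose E : R := \sum_k sgn (eps k).
  (* The first coordinate is chosen so that [G v] is the signed sum of the [g k x - f x], while all
     coordinates add up to 0. *)
  pose v : V := (- E *: x, [ffun k => sgn (eps k) *: x]).
  have -> : \sum_k sgn (eps k) * (g k x - f x) = G v.
    have -> : v = (- E) *: (x, 0) + \sum_k sgn (eps k) *: inj k x.
      congr (_, _).
        rewrite (big_morph (fun v : V => v.1) (id1 := 0) (op1 := +%R))//.
        by rewrite big1 ?addr0// => k _; exact: scaler0.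
      rewrite (big_morph (fun v : V => v.2) (id1 := 0) (op1 := +%R))//.
      rewrite /= scaler0 add0r; apply/ffunP => j; rewrite sum_ffunE ffunE.
      rewrite (bigD1 j)//= !ffunE eqxx big1 ?addr0// => k kj.
      by rewrite !ffunE eq_sym (negPf kj) scaler0.
    have GZ a w : G (a *: w) = a * G w by rewrite linearZ.
    rewrite linearD GZ (linear_sum G) G0 mulNr mulr_suml addrC -sumrB.
    by apply: eq_bigr => k _; rewrite GZ mulrBr.
  apply: le_trans (GP _) _; rewrite /P.
  have -> : total v = T 0.
    rewrite linear0 /total/=; under eq_bigr do rewrite ffunE.
    by rewrite -scaler_suml -scalerDl addNr scale0r.
  rewrite -[leRHS]addr0 lerD ?dist_rangeT//.
  apply: (eventual_sup_le psi_bounded i0 (m := 0%N)) => n [s b] _.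
  apply: le_trans (ler_norm _) _; rewrite normrM norm_sgn mul1r/=.
  apply: le_trans (average_set_bit c0 z_le n s eps b x L0).
  under [in leLHS]eq_bigr do rewrite ffunE averageZ.
  rewrite averageZ mulNr mulr_suml -sumrN -big_split/=.
  rewrite le_eqVlt; apply/orP; left; apply/eqP; congr `|_|.
  by apply: eq_bigr => k _; ring.
Qed.

End renorming_ell1.

(** * Octahedral biduals *)

Section totally_bounded.
Context {R : realType}.

Lemma itv_net (A d : R) : 0 < d -> exists G : seq R,
  forall a, `|a| <= A -> exists2 b, b \in G & `|a - b| <= d.
Proof.
move=> d0; pose G := [seq - A + j%:R * d | j <- iota 0 (Num.truncn (2 * A / d)).+1].
exists G => a; rewrite ler_norml => /andP[Aa aA].
have aA0 : 0 <= (a + A) / d by rewrite divr_ge0//; lra.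
have /andP[ja aj] := truncn_itv aA0; set j := Num.truncn _ in ja aj.
exists (- A + j%:R * d).
  apply/mapP; exists j => //; rewrite mem_iota/= add0n ltnS.
  by apply: le_truncn; rewrite ler_pM2r ?invr_gt0//; lra.
rewrite ler_pdivlMr// in ja; rewrite ltr_pdivrMr// -natr1 in aj.
by rewrite ler_norml; apply/andP; split; lra.
Qed.

(** Induction on the generators, which may be dependent. If the last one [v] stays at distance at
    least [r > 0] from the span of the others, its coefficient is at most [M / r], and nets for that
    coefficient and for the remaining sum combine. *)
Lemma span_totally_bounded (V : normedModType R) n (e : 'I_n -> V) (M d : R) :
  0 < d -> exists s : seq V, forall a : 'I_n -> R,
    `|\sum_(i < n) a i *: e i| <= M ->
    exists2 u, u \in s & `|\sum_(i < n) a i *: e i - u| <= d.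
Proof.
elim: n => [|n IHn] in e M d *; move=> d0.
  exists [:: 0] => a _; exists 0; rewrite ?mem_head//.
  by rewrite big_ord0 subrr normr0 ltW.
pose e' i := e (widen_ord (leqnSn n) i); pose v := e ord_max.
have d20 : 0 < d / 2 by rewrite divr_gt0.
have [[r r0 rv]|nov] := pselect (exists2 r, 0 < r &
    forall b : 'I_n -> R, r <= `|v - \sum_(i < n) b i *: e' i|).
  pose A := M / r.
  have [s hs] := IHn e' (M + A * `|v|) (d / 2) d20.
  have v0 : 0 < `|v| + 1 by rewrite ltr_wpDl.
  have [G hG] := @itv_net A (d / 2 / (`|v| + 1)) (divr_gt0 d20 v0).
  exists [seq u + b *: v | u <- s, b <- G] => a.
  rewrite big_ord_recr/= -/v; set x := \sum_(i < n) _; set t := a ord_max => xM.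
  have tr : `|t| * r <= `|x + t *: v|.
    have [->|t0] := eqVneq t 0; first by rewrite normr0 mul0r.
    have -> : x + t *: v =
        t *: (v - \sum_(i < n) (- t^-1 * a (widen_ord (leqnSn n) i)) *: e' i).
      rewrite scalerBr addrC scaler_sumr -sumrN; congr (_ + _).
      apply: eq_bigr => i _; rewrite scalerA -scaleNr mulNr mulrN opprK mulrA.
      by rewrite divff// mul1r.
    by rewrite normrZ ler_wpM2l.
  have tA : `|t| <= A by rewrite ler_pdivlMr// (le_trans tr).
  have xM' : `|x| <= M + A * `|v|.
    rewrite -[x in leLHS](addrK (t *: v)); apply: le_trans (ler_normB _ _) _.
    by rewrite lerD// normrZ ler_wpM2r.
  have [u us xu] := hs _ xM'; have [b bG tb] := hG _ tA.
  exists (u + b *: v); first by apply/allpairsP; exists (u, b).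
  have -> : x + t *: v - (u + b *: v) = (x - u) + (t - b) *: v.
    by rewrite opprD addrACA scalerBl.
  rewrite [d]splitr; apply: le_trans (ler_normD _ _) _; rewrite lerD//.
  rewrite normrZ; rewrite ler_pdivlMr// in tb; apply: le_trans tb.
  by rewrite ler_wpM2l// lerDl.
(* Here [v] is a limit of elements of the span of [e'], so a net of the
   latter suffices. *)
have [s hs] := IHn e' (M + d / 2) (d / 2) d20.
exists s => a; rewrite big_ord_recr/= -/v.
set x := \sum_(i < n) _; set t := a ord_max => xM.
have t0 : 0 < `|t| + 1 by rewrite ltr_wpDl.
have [b vb] : exists b : 'I_n -> R,
    `|v - \sum_(i < n) b i *: e' i| < d / 2 / (`|t| + 1).
  apply: contrapT => nob; apply: nov.
  exists (d / 2 / (`|t| + 1)) => [|b]; first exact: divr_gt0.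
  by rewrite leNgt; apply/negP => vb; apply: nob; exists b.
pose y := \sum_(i < n) (a (widen_ord (leqnSn n) i) + t * b i) *: e' i.
have xy : `|x + t *: v - y| <= d / 2.
  have -> : x + t *: v - y = t *: (v - \sum_(i < n) b i *: e' i).
    rewrite /y; under [X in _ - X]eq_bigr do rewrite scalerDl -scalerA.
    by rewrite big_split/= -/x opprD addrACA subrr add0r -scaler_sumr -scalerBr.
  rewrite normrZ; rewrite ltr_pdivlMr// in vb; apply: le_trans (ltW vb).
  by rewrite mulrC ler_wpM2l// lerDl.
have yM : `|y| <= M + d / 2.
  rewrite -[y](subKr (x + t *: v)); apply: le_trans (ler_normB _ _) _.
  exact: lerD.
have [u us yu] := hs _ yM; exists u => //.
rewrite -[x + _](subrK y) -addrA [d]splitr.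
by apply: le_trans (ler_normD _ _) _; exact: lerD.
Qed.

End totally_bounded.

Section dual_lemmas.
Context {R : realType} {Z : normedModType R}.

Lemma dual_le (f : dual Z) x : `|f x| <= `|f| * `|x|.
Proof.
have [->|x0] := eqVneq x 0; first by rewrite linear0 !normr0 mulr0.
have := @dual_norm_ub _ _ f (`|x|^-1 *: x).
rewrite normrZ normfV normr_id mulVf ?normr_eq0// => /(_ (lexx 1)).
by rewrite linearZ normrM normfV normr_id ler_pdivrMl ?normr_gt0// mulrC.
Qed.

Lemma scalar_dual (f : {scalar Z}) M : (forall x, f x <= M * `|x|) ->
  exists g : dual Z, forall x, g x = f x.
Proof.
move=> fM.
pose F : {linear Z -> R^o} := HB.pack (f : Z -> R^o)
  (GRing.isLinear.Build R Z R^o *:%R (f : Z -> R^o) (@linearP _ _ _ _ f)).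
have cF : continuous F.
  apply/linear_bounded_continuous/linear_boundedP.
  near=> r => x; apply: (@le_trans _ _ (M * `|x|)).
    rewrite ler_norml fM andbT lerNl.
    by have := fM (- x); rewrite linearN normrN.
  by rewrite ler_wpM2r//; near: r; apply: nbhs_pinfty_ge; exact: num_real.
have Fd : (f : Z -> R^o) \in @is_dual R Z.
  by apply/is_dualP; split=> //; exact: (@linearP _ _ _ _ F).
by exists (Dual Fd).
Unshelve. all: by end_near. Qed.

Lemma dual_normP (f : dual Z) M :
  (forall x, `|x| <= 1 -> f x <= M) -> `|f| <= M.
Proof.
move=> fM; apply: dual_norm_le => x x1; rewrite ler_norml fM// andbT lerNl.
by have := fM (- x); rewrite linearN normrN; exact.
Qed.

Lemma dual_norm_approx (f : dual Z) (r : R) : r < `|f| ->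
  exists x, `|x| <= 1 /\ r < f x.
Proof.
move=> rf.
have [_ [x /= x1 <-]] := sup_gt (dual_norm_has_sup f).1 rf.
have [fx|fx] := leP 0 (f x); first by rewrite ger0_norm//; exists x.
by rewrite ltr0_norm// -linearN; exists (- x); rewrite normrN.
Qed.

Lemma dual_sum (I : finType) (F : I -> dual Z) x :
  (\sum_i F i) x = \sum_i (F i x : R).
Proof. by apply: (big_morph (fun f : dual Z => f x : R)). Qed.

End dual_lemmas.

Lemma eval_dual (R : realType) (Z : normedModType R) (x : Z) :
  exists y : dual (dual Z), `|y| <= `|x| /\ forall f, y f = f x.
Proof.
have ev_scalar : scalar (fun f : dual Z => f x : R) by [].
pose ev : {scalar (dual Z)} := HB.pack (fun f : dual Z => f x : R)
  (GRing.isLinear.Build R (dual Z) R *%R _ ev_scalar).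
have ev_le f : ev f <= `|x| * `|f|.
  by rewrite mulrC; exact: le_trans (ler_norm _) (dual_le f x).
have [y yE] := scalar_dual ev_le.
exists y; split=> //; apply: dual_normP => f f1; rewrite yE.
by apply: le_trans (ev_le f) _; rewrite ler_piMr.
Qed.

(** * From perturbations in the dual ball to octahedrality *)

Section octahedral_bidual.
Context {R : realType} {Z : normedModType R}.
Variables (B : R) (e : nat -> Z).
Hypothesis e_le1 : forall k, `|e k| <= 1.
Hypothesis perturb : forall (f : dual Z) L, `|f| <= 1 -> (0 < L)%N ->
  exists g : 'I_(L ^ 2) -> dual Z,
  [/\ forall k, `|g k| <= 1, forall k, 1 <= g k (e k) &
    forall eps : 'I_(L ^ 2) -> bool,
      `|\sum_k (sgn (eps k) : R) *: (g k - f)| <= B * L%:R].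

Lemma bidual_direction (s : seq (dual (dual Z))) (d : R) : 0 < d ->
  exists y : dual (dual Z), `|y| = 1 /\
    forall F, F \in s -> `|F| + 1 - d <= `|F + y|.
Proof.
move=> d0; have d20 : 0 < d / 2 by rewrite divr_gt0.
have /choice[f fP] : forall F : dual (dual Z), exists f : dual Z,
    `|f| <= 1 /\ `|F| - d / 2 < F f.
  by move=> F; apply: dual_norm_approx; rewrite ltrBlDr ltrDl.
pose S := \sum_(F <- s) `|F|.
(* Large enough that [S * (B * L)] is below [L ^ 2] terms of size [d / 2]. *)
pose L := (Num.truncn (B * S / (d / 2))).+1.
have L0 : 0 < L%:R :> R by rewrite ltr0n.
have BSL : B * S < d / 2 * L%:R.
  rewrite [ltRHS]mulrC -ltr_pdivrMr//.
  have [BS0|BS0] := leP 0 (B * S / (d / 2)).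
    by have /andP[] := truncn_itv BS0.
  exact: lt_trans BS0 L0.
have /choice[g gP] : forall F : dual (dual Z), exists g : 'I_(L ^ 2) -> dual Z,
  [/\ forall k, `|g k| <= 1, forall k, 1 <= g k (e k) &
    forall eps : 'I_(L ^ 2) -> bool,
      `|\sum_k (sgn (eps k) : R) *: (g k - f F)| <= B * L%:R].
  by move=> F; apply: perturb; rewrite ?(fP F).1.
have F_sum (F : dual (dual Z)) : \sum_k `|F (g F k - f F) : R| <= `|F| * (B * L%:R).
  have [_ _ gB] := gP F.
  (* With these signs, linearity of [F] turns the norm bound on the signed sum into a bound on a sum
     of absolute values. *)
  pose eps k := 0 <= (F (g F k - f F) : R).
  have -> : \sum_k `|F (g F k - f F) : R| =
      F (\sum_k (sgn (eps k) : R) *: (g F k - f F)).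
    rewrite linear_sum; apply: eq_bigr => k _; rewrite linearZ /eps /sgn.
    case: (leP 0 (F (g F k - f F) : R)) => [F0|F0].
      by rewrite ger0_norm//; exact/esym/mul1r.
    by rewrite ltr0_norm//; exact/esym/mulN1r.
  apply: le_trans (ler_norm _) _; apply: le_trans (dual_le F _) _.
  by rewrite ler_wpM2l.
(* The sums over [k < L ^ 2] grow only like [L], so some term is small. *)
have [k kP] : exists k : 'I_(L ^ 2),
    \sum_(F <- s) `|F (g F k - f F) : R| <= d / 2.
  apply: contrapT => nok.
  have : \sum_(k < L ^ 2) (d / 2) <=
      \sum_(k < L ^ 2) \sum_(F <- s) `|F (g F k - f F) : R|.
    apply: ler_sum => k _; rewrite leNgt; apply/negP => kd; apply: nok.
    by exists k; exact: ltW.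
  rewrite sumr_const card_ord -[_ *+ _]mulr_natr natrX exchange_big/=.
  apply/negP; rewrite -ltNge.
  apply: (@le_lt_trans _ _ (\sum_(F <- s) `|F| * (B * L%:R))).
    by apply: ler_sum => F _; exact: F_sum.
  by rewrite -mulr_suml -/S mulrCA mulrA expr2 mulrA ltr_pM2r.
have [y [y1 yE]] := eval_dual (e k).
have {}y1 : `|y| <= 1 by exact: le_trans y1 (e_le1 k).
exists y; split.
  apply/eqP; rewrite eq_le y1/=.
  (* A functional of norm at most 1 with value at least 1 at [e k] forces [|y| >= 1]; the index 0 is
     available even if [s] is empty. *)
  have [g1 ge _] := gP 0.
  apply: le_trans (ge k) _; rewrite -yE.
  apply: le_trans (ler_norm _) _; apply: le_trans (dual_le _ _) _.
  by rewrite ler_piMr.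
move=> F Fs; have [g1 ge _] := gP F.
have Fg : `|F (g F k - f F) : R| <= d / 2.
  apply: le_trans kP; rewrite (big_rem F)//= lerDl.
  by apply: sumr_ge0 => *.
have Fyg : (F (g F k) : R) + y (g F k) <= `|F + y|.
  have := dual_le (F + y) (g F k).
  have -> : (F + y) (g F k) = F (g F k) + y (g F k) by [].
  move=> /(le_trans (ler_norm _))/le_trans; apply.
  by rewrite ler_piMr.
have lin : F (g F k - f F) = (F (g F k) : R) - F (f F) :> R := linearB F _ _.
have Fgd : - (d / 2) <= (F (g F k) : R) - F (f F).
  by move: Fg; rewrite lin ler_norml => /andP[].
have yg : 1 <= (y (g F k) : R) by rewrite yE.
have Ff : `|F| - d / 2 < (F (f F) : R) := (fP F).2.
by lra.
Qed.

Theorem octahedral_bidual : octahedral (dual (dual Z)).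
Proof.
move=> E [n [b ->]] eps eps0.
have d0 : 0 < eps / 3 by rewrite divr_gt0.
(* If [|x| > 2 / eps], the estimate [|x + y| >= |x| - 1] suffices. Otherwise three errors of
   [eps / 3] occur: two from passing between [x] and its net point, one from [bidual_direction]. *)
have [s sP] := @span_totally_bounded R (dual (dual Z)) n b (2 / eps) _ d0.
have [y [y1 yP]] := bidual_direction s d0.
exists y; split=> // _ [a ->]; rewrite y1.
set x := \sum_(i < n) _.
have [xM|Mx] := leP `|x| (2 / eps).
  have [u us xu] := sP a xM; rewrite -/x in xu.
  have := yP _ us.
  have : `|u + y| <= `|x + y| + `|x - u|.
    have -> : u + y = x + y - (x - u) by rewrite opprB [RHS]addrC addrA subrK.
    exact: ler_normB.
  have : `|x| <= `|u| + `|x - u|.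
    by rewrite -[x in leLHS](subrK u) addrC ler_normD.
  have := mulr_ge0 (ltW eps0) (normr_ge0 x).
  rewrite mulrBl mul1r mulrDr mulr1; move: xu.
  move: (eps * `|x|) `|x - u| `|u + y| `|x + y| `|u| `|x| => t1 t2 t3 t4 t5 t6.
  lra.
have : `|x| <= `|x + y| + 1.
  by rewrite -y1 -[x in leLHS](addrK y) ler_normB.
by rewrite ltr_pdivrMr// in Mx; lra.
Qed.

End octahedral_bidual.

Theorem corollary4p3 (R : realType) (X : completeNormedModType R) :
  separable_complementation_property X ->
  contains_isomorphic_copy (ell1 R) X ->
  exists N : equivalent_norm X, octahedral (dual (dual (renormed N))).
Proof.
move=> _ [T [c [C' [c0 TcC]]]].
pose C := Num.max C' 1.
have C0 : 0 < C by rewrite lt_max ltr01 orbT.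
have TC u : `|T u| <= C * `|u|.
  have /andP[_ /le_trans] := TcC u; apply.
  by rewrite ler_wpM2r// le_max lexx.
have cT u : c * `|u| <= `|T u| by have /andP[] := TcC u.
(* A single choice over dependent pairs covers all word lengths at once. *)
have /choice[z zP] : forall nw : {n & {ffun 'I_n -> bool}},
    exists z : {scalar X}, (forall x, `|z x| <= c^-1 * `|x|) /\
    (forall u, z (T u) = \sum_(i < tag nw) u i * sgn (tagged nw i)).
  by move=> [n w]; exact: sign_functional c0 cT n w.
pose z' n w := z (existT _ n w).
have z_le n w x : `|z' n w x| <= c^-1 * `|x| := (zP (existT _ n w)).1 x.
have zT n w u : z' n w (T u) = \sum_(i < n) u i * sgn (w i) :=
  (zP (existT _ n w)).2 u.
pose N := ell1_equivalent_norm c0 C0 z_le zT TC.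
exists N.
pose Z : normedModType R := renormed N.
pose K : R := 1 + 2 * C + 2 * (C / c).
have normX (x : X) : `|x| <= K * `|x : Z| := ell1_renorm_ge c0 C0 z_le zT TC x.
have K0 : 0 < K by rewrite !addr_gt0// !mulr_gt0// invr_gt0.
(* The factor [K] converts the new unit ball into a bound on the original norm, in which
   [perturbed_functionals] is stated. *)
apply: (@octahedral_bidual R Z (2 * (c^-1 * K)) (fun k => 2 *: T (ell1_unit k))).
  move=> k; exact: (ell1_renorm_unit z_le zT k).
move=> f L f1 L0.
have f_scalar : scalar (fun x : X => f (x : Z) : R) by exact: (linearP f).
pose f' : {scalar X} := HB.pack (fun x : X => f (x : Z) : R)
  (GRing.isLinear.Build R X R *%R _ f_scalar).
have fN (x : X) : f' x <= ell1_renorm T z' x.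
  apply: le_trans (ler_norm _) _; apply: le_trans (dual_le f (x : Z)) _.
  by rewrite ler_piMl.
have [g [gN ge gsum]] := perturbed_functionals c0 z_le zT L0 fN.
have /choice[h hE] : forall k, exists h : dual Z, forall x, h x = g k x.
  move=> k; pose g' : {scalar Z} := g k.
  by apply: (@scalar_dual _ _ g' 1) => x; rewrite mul1r; exact: gN.
exists h; split=> [k|k|eps].
- by apply: dual_normP => x x1; rewrite hE; exact: le_trans (gN k x) x1.
- by rewrite hE.
apply: dual_normP => x x1; rewrite dual_sum.
have -> : \sum_k ((sgn (eps k) *: (h k - f)) x : R) =
    \sum_k sgn (eps k) * (g k x - f' x).
  by apply: eq_bigr => k _; rewrite -hE.
apply: le_trans (gsum eps x) _.
have xK : `|x : X| <= K.
  by apply: le_trans (normX x) _; rewrite ler_piMr// ltW.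
rewrite [leRHS]mulrAC ler_wpM2l ?mulr_ge0//.
by rewrite ler_wpM2l// invr_ge0 ltW.
Qed.
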